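(* Let $e\ge 1$, let $Q=\mathbb{Z}_{q_1}\times\mathbb{Z}_{q_2}\times\cdots\times\mathbb{Z}_{q_n}$ with $q_i\le q_j$ for $i<j$, and let $\mathcal{C}\subseteq Q$ be an $e$-perfect mixed code that contains the all-zero word. Then the set of codewords of $\mathcal{C}$ of weight $2e+1$ is a mixed Steiner system $\mathrm{MS}(e+1,2e+1,Q)$.
   Context: Here $q_1,\dots,q_n\ge 2$ are integers and $Q$ is viewed as the set of words of length $n$ whose $i$-th letter lies in $\mathbb{Z}_{q_i}$. The weight of a word is its number of nonzero coordinates, and $d(\cdot,\cdot)$ is the Hamming distance. An $e$-perfect mixed code over $Q$ is a set $\mathcal{C}\subseteq Q$ such that for each $x\in Q$ there is a unique $c\in\mathcal{C}$ with $d(x,c)\le e$. For integers $1\le t\le k$, a mixed Steiner system $\mathrm{MS}(t,k,Q)$ is a set $\mathcal{D}$ of words of $Q$ of weight $k$ such that (i) for every word $x\in Q$ of weight $t$ there is exactly one $c\in\mathcal{D}$ with $d(x,c)=k-t$; and (ii) any two distinct elements of $\mathcal{D}$ are at Hamming distance at least $2(k-t)+1$. *)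

(* Defs.v *)
From mathcomp Require Import all_boot all_order all_algebra.

Set Implicit Arguments.
Unset Strict Implicit.
Unset Printing Implicit Defensive.

Import GRing.Theory.

(* 'Z_m is the ring of integers mod m only for m >= 2; hence these notions have
   their intended meaning only when every q i is at least 2. *)
Definition word (n : nat) (q : 'I_n -> nat) := {dffun forall i : 'I_n, 'Z_(q i)}.

Definition zero_word (n : nat) (q : 'I_n -> nat) : word q :=
  [ffun i : 'I_n => (0%R : 'Z_(q i))].

Definition weight (n : nat) (q : 'I_n -> nat) (x : word q) : nat :=
  #|[set i : 'I_n | x i != 0%R]|.

Definition hamming (n : nat) (q : 'I_n -> nat) (x y : word q) : nat :=
  #|[set i : 'I_n | x i != y i]|.

Definition perfect_mixed_code (n : nat) (q : 'I_n -> nat) (e : nat)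
    (C : {set word q}) : Prop :=
  forall x : word q, exists! c : word q, c \in C /\ hamming x c <= e.

Definition mixed_steiner_system (n : nat) (q : 'I_n -> nat) (t k : nat)
    (D : {set word q}) : Prop :=
  [/\ 1 <= t <= k,
      forall c : word q, c \in D -> weight c = k,
      forall x : word q, weight x = t ->
        exists! c : word q, c \in D /\ hamming x c = k - t
    & forall c d : word q, c \in D -> d \in D -> c != d ->
        2 * (k - t) + 1 <= hamming c d].

(* Main.v *)
(* Distinct codewords of an e-perfect code are at distance at least 2e + 1:
   otherwise a word halfway between them would lie in both of their balls.
   Since the zero word is a codeword, nonzero codewords have weight at least
   2e + 1. If x has weight e + 1, the codeword c covering x is therefore nonzero,
   and the triangle inequality on 0, x, c forces weight c = 2e + 1 and
   d(x, c) = e. *)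
Require Import Defs.
From mathcomp Require Import all_boot all_order all_algebra.
From mathcomp Require Import zify.

Section Hamming.
Variables (n : nat) (q : 'I_n -> nat).
Implicit Types x y z : word q.

Lemma hammingC x y : hamming x y = hamming y x.
Proof. by apply: eq_card => i; rewrite !inE eq_sym. Qed.

Lemma hamming_triangle x y z : hamming x z <= hamming x y + hamming y z.
Proof.
rewrite (leq_trans _ (leq_card_setU _ _)) //; apply/subset_leq_card/subsetP => i.
by rewrite !inE; case: (eqVneq (x i) (y i)) => [->|].
Qed.

Lemma hamming_zero x : hamming x (zero_word q) = weight x.
Proof. by apply: eq_card => i; rewrite !inE ffunE. Qed.

(** Walk from [x] to [y], correcting one differing coordinate at a time: [z] is the word reached
    after [a] corrections, or [y] itself if fewer suffice. *)
Lemma hamming_split x y a b : hamming x y <= a + b ->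
  exists z, hamming x z <= a /\ hamming z y <= b.
Proof.
set S := [set i | x i != y i] => leS.
have leSab : #|S| <= a + b by [].
pose A := [set i in take a (enum S)].
have memA i : (i \in A) = (i \in take a (enum S)) by rewrite inE.
exists [ffun i => if i \in A then y i else x i]; split.
  apply: (@leq_trans #|A|).
    apply/subset_leq_card/subsetP => i; rewrite inE ffunE.
    by case: (i \in A); rewrite ?eqxx.
  by rewrite cardsE (leq_trans (card_size _)) // size_take_min geq_minl.
apply: (@leq_trans #|[set i in drop a (enum S)]|).
  apply/subset_leq_card/subsetP => i; rewrite inE ffunE.
  case: ifPn => [|/negPf iA neq_xy]; first by rewrite eqxx.
  have : i \in take a (enum S) ++ drop a (enum S).
    by rewrite cat_take_drop mem_enum inE.
  by rewrite mem_cat -memA iA inE.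
rewrite cardsE (leq_trans (card_size _)) // size_drop -cardE.
by rewrite leq_subLR.
Qed.

Lemma perfect_code_distance e (C : {set word q}) (c d : word q) :
  perfect_mixed_code e C -> c \in C -> d \in C -> c != d ->
  2 * e + 1 <= hamming c d.
Proof.
move=> perfC cC dC /eqP neq_cd; rewrite addn1 ltnNge mul2n -addnn.
apply/negP => /hamming_split [z [le_cz le_zd]]; apply: neq_cd.
have [u [_ uniq_u]] := perfC z.
(* Both [c] and [d] cover [z], so both equal [u]. *)
rewrite -(uniq_u c); last by rewrite hammingC.
exact: uniq_u.
Qed.

End Hamming.

Theorem theorem8 (n : nat) (q : 'I_n -> nat) (e : nat) (C : {set word q})
    (q_ge2 : forall i : 'I_n, 2 <= q i)
    (q_mono : forall i j : 'I_n, i < j -> q i <= q j)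
    (e_ge1 : 1 <= e)
    (C_perfect : perfect_mixed_code e C)
    (C_zero : zero_word q \in C) :
  mixed_steiner_system (e + 1) (2 * e + 1)
    [set c in C | weight c == 2 * e + 1].
Proof.
(* In this form [addnK] turns [k - t] into [e]. *)
have -> : 2 * e + 1 = e + (e + 1) by lia.
split; first by lia.
- by move=> c; rewrite inE => /andP[_ /eqP].
- move=> x wx; rewrite addnK.
  have [c [[cC le_xc] uniq_c]] := C_perfect x.
  (* Uniqueness is inherited from perfection, since distance exactly [e] is in particular at most
     [e]. *)
  exists c; split; last first.
    move=> d [dD dist_xd]; apply: uniq_c; rewrite dist_xd leqnn.
    by move: dD; rewrite inE => /andP[-> _].
  have c_neq0 : c != zero_word q.
    by apply: contraTneq le_xc => ->; rewrite hamming_zero wx; lia.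
  (* The chain 2e + 1 <= weight c <= d(c, x) + e + 1 <= 2e + 1 collapses to equalities. *)
  have := perfect_code_distance _ _ _ _ _ _ C_perfect cC C_zero c_neq0.
  have := hamming_triangle _ _ c x (zero_word q).
  rewrite !hamming_zero wx (hammingC _ _ c) inE cC /= => le_wc ge_wc.
  by split; [apply/eqP; lia | lia].
- move=> c d; rewrite addnK !inE => /andP[cC _] /andP[dC _].
  exact: perfect_code_distance.
Qed.
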